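(* For every integer $n\ge 6$, with $k=\binom{n-3}{\lceil (n-3)/2\rceil}-\lceil n/2\rceil$, we have $h(n,k)>2^{n-2}+1$ (or $h(n,k)$ does not exist); i.e. there exists a set $\mathcal X$ of at least $2^{n-2}+1$ points in the plane in general position such that every convex $n$-gon with vertices in $\mathcal X$ contains more than $k$ points of $\mathcal X$ in its interior.
   Context: A finite planar point set is in general position if no three of its points are collinear. For integers $n\ge3$, $k\ge0$, $h(n,k)$ is the least positive integer (if it exists) such that every planar set $\mathcal X$ in general position with at least $h(n,k)$ points contains a convex $n$-gon $C$ with vertices in $\mathcal X$ whose interior contains at most $k$ points of $\mathcal X$. *)

(* Defs.v *)
From Stdlib Require Import Reals List Arith.
Open Scope R_scope.

Definition pt : Type := (R * R)%type.

(* Twice the signed area of triangle pqr: > 0 iff p,q,r are counterclockwise,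
   = 0 iff collinear. *)
Definition orient (p q r : pt) : R :=
  (fst q - fst p) * (snd r - snd p) - (snd q - snd p) * (fst r - fst p).

Definition general_position (X : list pt) : Prop :=
  NoDup X /\
  forall p q r, In p X -> In q X -> In r X ->
    p <> q -> q <> r -> p <> r -> orient p q r <> 0.

Definition nxt (n i : nat) : nat := Nat.modulo (S i) n.

(* v 0, ..., v (n-1) are the vertices of a convex n-gon listed in
   counterclockwise order: they are pairwise distinct and every other vertex
   lies strictly to the left of each directed edge v i -> v (i+1 mod n). *)
Definition convex_ngon (n : nat) (v : nat -> pt) : Prop :=
  (forall i j, (i < n)%nat -> (j < n)%nat -> i <> j -> v i <> v j) /\
  (forall i j, (i < n)%nat -> (j < n)%nat -> j <> i -> j <> nxt n i ->
     orient (v i) (v (nxt n i)) (v j) > 0).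

Definition in_interior (n : nat) (v : nat -> pt) (x : pt) : Prop :=
  forall i, (i < n)%nat -> orient (v i) (v (nxt n i)) x > 0.

Fixpoint binom (n k : nat) : nat :=
  match n, k with
  | _, O => 1%nat
  | O, S _ => 0%nat
  | S n', S k' => (binom n' k' + binom n' k)%nat
  end.

Definition ceil_half (m : nat) : nat := Nat.div (m + 1) 2.

(* k = C(n-3, ceil((n-3)/2)) - ceil(n/2)  (nonnegative for n >= 6) *)
Definition kval (n : nat) : nat :=
  (binom (n - 3) (ceil_half (n - 3)) - ceil_half n)%nat.

(* Main.v *)
(**
The Erdős–Szekeres set of [2 ^ (n - 2)] points without a convex [n]-gon is a stack of blocks,
the [i]-th one having caps of size at most [i + 1], cups of size at most [n - 1 - i] and
[binom (n - 2) i] points; a polygon meeting several blocks is made of a cap in the upper part,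
a cup in the lower part, which bounds its size.

One extra point is gained in a middle block by allowing it caps with one point too many,
provided that many points of the block lie below each of them: in an [n]-gon, such a cap is
completed by points far below, so that all these points are interior. Let [c] and [u] be
the cap and cup bounds of this block. An ordinary block is a union [L, P], where [P] lies
high to the right of [L], caps meeting both sets have at most one point in [L], and [L] can be
chosen as [u - 1] points on a cup followed, to the lower right, by a set [D]. Now give
that cup [u] points and make it so steep that [P] lies to the right of its secants. An
exceptional cap then has two points on the steep cup and continues in [P], with [D]
below it, and [D] has [binom (n - 3) (c - 1) - (u - 1)] points. The parameters
[c = floor (n / 2)] and [u = ceil (n / 2)] give the required number.
*)

Require Import Defs.
From Stdlib Require Import Reals List Arith.
From Stdlib Require Import Lra Lia Classical.
Open Scope R_scope.

(** * Caps, cups and points under or inside a configuration *)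

Definition cap (l : list pt) : Prop :=
  forall p q r, In p l -> In q l -> In r l ->
    fst p < fst q -> fst q < fst r -> orient p q r < 0.

Definition cup (l : list pt) : Prop :=
  forall p q r, In p l -> In q l -> In r l ->
    fst p < fst q -> fst q < fst r -> orient p q r > 0.

(** General position strengthened by distinct abscissas, so that triples read from left to right
    suffice; [sep_general_position] recovers the other orders. *)
Definition sep (X : list pt) : Prop :=
  NoDup X /\
  (forall p q, In p X -> In q X -> p <> q -> fst p <> fst q) /\
  (forall p q r, In p X -> In q X -> In r X ->
     fst p < fst q -> fst q < fst r -> orient p q r <> 0).

Definition cup_bound (X : list pt) (u : nat) : Prop :=
  forall l, NoDup l -> incl l X -> cup l -> (length l <= u)%nat.

(* [Q] describes the exceptional caps of [X] of size [c + 1]. *)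
Definition cap_bound (Q : list pt -> list pt -> Prop) (X : list pt) (c : nat) : Prop :=
  forall l, NoDup l -> incl l X -> cap l ->
    (length l <= c)%nat \/ (length l = S c /\ Q X l).

(** For ordinary blocks, which have no exceptional caps. *)
Definition never (X l : list pt) : Prop := False.

(** Keeps an exceptional cap exceptional when the set grows and the cap receives further points. *)
Definition monotone (Q : list pt -> list pt -> Prop) : Prop :=
  forall X X' l l', incl X X' -> incl l l' -> Q X l -> Q X' l'.

(** One chord is enough: together with a point far below, it spans a triangle around [y]. *)
Definition under (l : list pt) (y : pt) : Prop :=
  exists p r, In p l /\ In r l /\ fst p < fst y /\ fst y < fst r /\ orient p r y < 0.

Definition many_under (K : nat) (X l : list pt) : Prop :=
  exists Y, NoDup Y /\ (K <= length Y)%nat /\ forall y, In y Y -> In y X /\ under l y.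

Definition in_triangle (l : list pt) (y : pt) : Prop :=
  exists p q r, In p l /\ In q l /\ In r l /\
    orient p q y > 0 /\ orient q r y > 0 /\ orient r p y > 0.

Definition many_inside (K : nat) (X l : list pt) : Prop :=
  exists Y, NoDup Y /\ (K <= length Y)%nat /\ forall y, In y Y -> In y X /\ in_triangle l y.

(** By Carathéodory, triangles suffice to detect a point in the hull of the others; strict triangles
    do so in general position. *)
Definition convex_position (l : list pt) : Prop :=
  forall y, In y l -> ~ in_triangle l y.

(** * Lists *)

Lemma partition_prop (A : Type) (P : A -> Prop) (l : list A) :
  NoDup l -> exists l1 l2, NoDup l1 /\ NoDup l2 /\
    (forall x, In x l1 <-> In x l /\ P x) /\
    (forall x, In x l2 <-> In x l /\ ~ P x) /\
    length l = (length l1 + length l2)%nat.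
Proof.
  induction l as [|a l IH]; intros ND.
  - exists nil, nil. simpl. repeat split; try constructor; tauto.
  - inversion ND as [|? ? Ha ND']; subst.
    destruct (IH ND') as (l1 & l2 & N1 & N2 & H1 & H2 & HL).
    destruct (classic (P a)) as [Pa|Pa].
    + exists (a :: l1), l2. repeat split; auto.
      * constructor; auto. intro H. apply H1 in H. tauto.
      * destruct H as [<-|H]; simpl; auto. right. apply H1; auto.
      * destruct H as [<-|H]; auto. apply H1; auto.
      * intros [[<-|H] Px]; simpl; auto. right. apply H1; auto.
      * right. apply H2; auto.
      * apply H2; auto.
      * intros [[<-|H] Px]; [tauto|]. apply H2; auto.
      * simpl. lia.
    + exists l1, (a :: l2). repeat split; auto.
      * constructor; auto. intro H. apply H2 in H. tauto.
      * right. apply H1; auto.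
      * apply H1; auto.
      * intros [[<-|H] Px]; [tauto|]. apply H1; auto.
      * destruct H as [<-|H]; simpl; auto. right. apply H2; auto.
      * destruct H as [<-|H]; auto. apply H2; auto.
      * intros [[<-|H] Px]; simpl; auto. right. apply H2; auto.
      * simpl. lia.
Qed.

Lemma split_app (A : Type) (X Y l : list A) :
  NoDup l -> incl l (X ++ Y) -> exists l1 l2, NoDup l1 /\ NoDup l2 /\
    incl l1 X /\ incl l2 Y /\ incl l1 l /\ incl l2 l /\
    length l = (length l1 + length l2)%nat /\
    (forall x, In x l -> In x l1 \/ In x l2).
Proof.
  intros ND HI.
  destruct (partition_prop A (fun x => In x X) l ND)
    as (l1 & l2 & N1 & N2 & H1 & H2 & HL).
  exists l1, l2. repeat split; auto.
  - intros x Hx. apply H1 in Hx. tauto.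
  - intros x Hx. apply H2 in Hx. destruct Hx as [Hx HX].
    apply HI in Hx. apply in_app_or in Hx. tauto.
  - intros x Hx. apply H1 in Hx. tauto.
  - intros x Hx. apply H2 in Hx. tauto.
  - intros x Hx. destruct (classic (In x X)); [left; apply H1|right; apply H2]; auto.
Qed.

Lemma two_elements (A : Type) (l : list A) :
  NoDup l -> (2 <= length l)%nat -> exists x y, In x l /\ In y l /\ x <> y.
Proof.
  destruct l as [|x [|y l]]; simpl; intros ND H; try lia.
  exists x, y. repeat split; auto. intros ->. inversion ND; subst. simpl in *. tauto.
Qed.

Lemma two_ordered (X l : list pt) :
  sep X -> incl l X -> NoDup l -> (2 <= length l)%nat ->
  exists p q, In p l /\ In q l /\ fst p < fst q.
Proof.
  intros (_ & HX & _) HI ND H2.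
  destruct (two_elements _ l ND H2) as (p & q & Hp & Hq & Hpq).
  assert (fst p <> fst q) by (apply HX; auto).
  destruct (Rtotal_order (fst p) (fst q)) as [H'|[H'|H']]; [exists p, q| |exists q, p]; tauto.
Qed.

Lemma nonempty_length (A : Type) (l : list A) :
  (1 <= length l)%nat -> exists x, In x l.
Proof. destruct l as [|x l]; simpl; [lia|]. exists x; auto. Qed.

Lemma min_max_abscissa (l : list pt) :
  (1 <= length l)%nat ->
  exists a b, In a l /\ In b l /\ forall x, In x l -> fst a <= fst x <= fst b.
Proof.
  induction l as [|c l IH]; simpl; [lia|]. intros _.
  destruct l as [|d l].
  - exists c, c. simpl. repeat split; auto; destruct H as [<-|[]]; lra.
  - destruct IH as (a & b & Ha & Hb & H); [simpl; lia|].
    exists (if Rle_dec (fst c) (fst a) then c else a),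
           (if Rle_dec (fst b) (fst c) then c else b).
    split; [destruct Rle_dec; auto|]. split; [destruct (Rle_dec (fst b)); auto|].
    intros x [<-|Hx].
    + destruct Rle_dec, (Rle_dec (fst b)); pose proof (H _ Ha); lra.
    + apply H in Hx. destruct Rle_dec, (Rle_dec (fst b)); lra.
Qed.

(** * Orientations and general position *)

Lemma orient_rot (p q r : pt) : orient p q r = orient q r p.
Proof. unfold orient; ring. Qed.

Lemma orient_swap (p q r : pt) : orient p r q = - orient p q r.
Proof. unfold orient; ring. Qed.

Lemma sep_general_position (X : list pt) : sep X -> general_position X.
Proof.
  intros (ND & HX & HO). split; auto.
  intros p q r Hp Hq Hr Hpq Hqr Hpr H0.
  assert (A := HX p q Hp Hq Hpq). assert (B := HX q r Hq Hr Hqr).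
  assert (C := HX p r Hp Hr Hpr).
  assert (O1 := HO p q r Hp Hq Hr). assert (O2 := HO p r q Hp Hr Hq).
  assert (O3 := HO q p r Hq Hp Hr). assert (O4 := HO q r p Hq Hr Hp).
  assert (O5 := HO r p q Hr Hp Hq). assert (O6 := HO r q p Hr Hq Hp).
  unfold orient in *.
  destruct (Rtotal_order (fst p) (fst q)) as [?|[?|?]]; try tauto;
  destruct (Rtotal_order (fst q) (fst r)) as [?|[?|?]]; try tauto;
  destruct (Rtotal_order (fst p) (fst r)) as [?|[?|?]]; try tauto; try lra;
  first [ apply O1; lra | apply O2; lra | apply O3; lra
        | apply O4; lra | apply O5; lra | apply O6; lra ].
Qed.

Lemma sep_singleton (p : pt) : sep (p :: nil).
Proof.
  repeat split.
  - constructor; [auto|constructor].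
  - simpl. intros a b [<-|[]] [<-|[]]; tauto.
  - simpl. intros a b c [<-|[]] [<-|[]]; lra.
Qed.

Lemma sep_nil : sep nil.
Proof. repeat split; simpl; try tauto. constructor. Qed.

Lemma cap_incl (l l' : list pt) : incl l l' -> cap l' -> cap l.
Proof. intros HI HC p q r Hp Hq Hr. apply HC; auto. Qed.

Lemma cup_incl (l l' : list pt) : incl l l' -> cup l' -> cup l.
Proof. intros HI HC p q r Hp Hq Hr. apply HC; auto. Qed.

Lemma incl_convex_position (l l' : list pt) :
  incl l l' -> convex_position l' -> convex_position l.
Proof.
  intros HI HC y Hy (p & q & r & Hp & Hq & Hr & H).
  apply (HC y (HI _ Hy)). exists p, q, r; repeat split; auto; tauto.
Qed.

Lemma monotone_never : monotone never.
Proof. intros X X' l l' _ _ []. Qed.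

Lemma under_incl (l l' : list pt) (y : pt) : incl l l' -> under l y -> under l' y.
Proof. intros HI (p & r & Hp & Hr & H). exists p, r. split; auto. Qed.

Lemma monotone_many_under (K : nat) : monotone (many_under K).
Proof.
  intros X X' l l' HX Hl (Y & ND & HK & HY). exists Y. repeat split; auto.
  - apply HX, HY; auto.
  - eapply under_incl; eauto. apply HY; auto.
Qed.

Lemma monotone_many_inside (K : nat) : monotone (many_inside K).
Proof.
  intros X X' l l' HX Hl (Y & ND & HK & HY). exists Y. repeat split; auto.
  - apply HX, HY; auto.
  - destruct (HY y H) as (_ & p & q & r & Hp & Hq & Hr & H').
    exists p, q, r; repeat split; auto; tauto.
Qed.

Lemma cap_bound_never (Q : list pt -> list pt -> Prop) (X : list pt) (c : nat) :
  cap_bound never X c -> cap_bound Q X c.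
Proof. intros H l ND HI HC. destruct (H l ND HI HC) as [?|[_ []]]; auto. Qed.

Lemma cap_bound_never_le (X l : list pt) (c : nat) :
  cap_bound never X c -> NoDup l -> incl l X -> cap l -> (length l <= c)%nat.
Proof. intros H ND HI HC. destruct (H l ND HI HC) as [?|[_ []]]; auto. Qed.

(** * Convex polygons *)

(** The function [orient a b] is affine, and the three areas at [y] are its unnormalised barycentric
    coordinates. *)
Lemma barycentric (a b p q r y : pt) :
  orient a b y * orient p q r =
  orient q r y * orient a b p + orient r p y * orient a b q + orient p q y * orient a b r.
Proof. unfold orient; ring. Qed.

Lemma orient_triangle_sum (p q r y : pt) :
  orient p q r = orient p q y + orient q r y + orient r p y.
Proof. unfold orient; ring. Qed.

Lemma orient_eq1 (p q : pt) : orient p q p = 0.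
Proof. unfold orient; ring. Qed.

Lemma orient_eq2 (p q : pt) : orient p q q = 0.
Proof. unfold orient; ring. Qed.

Lemma orient_eq0 (p q : pt) : orient p p q = 0.
Proof. unfold orient; ring. Qed.

Lemma in_vertices (n : nat) (v : nat -> pt) (p : pt) :
  In p (map v (seq 0 n)) <-> exists i, (i < n)%nat /\ v i = p.
Proof.
  rewrite in_map_iff. split.
  - intros (i & <- & Hi). apply in_seq in Hi. exists i; split; auto; lia.
  - intros (i & Hi & <-). exists i; split; auto. apply in_seq. lia.
Qed.

(** Relative to an edge, no vertex has negative area. By [barycentric], the area of [y] is, up to
    the positive factor [orient p q r], a combination of such areas with positive coefficients. *)
Lemma triangle_interior (n : nat) (v : nat -> pt) (y : pt) :
  convex_ngon n v -> in_triangle (map v (seq 0 n)) y -> in_interior n v y.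
Proof.
  intros [_ HC] (p & q & r & Hp & Hq & Hr & H1 & H2 & H3) i Hi.
  set (a := v i). set (b := v (nxt n i)).
  assert (HV : forall z, In z (map v (seq 0 n)) -> z = a \/ z = b \/ orient a b z > 0).
  { intros z Hz. apply in_vertices in Hz. destruct Hz as (j & Hj & <-).
    destruct (Nat.eq_dec j i) as [->|]; auto.
    destruct (Nat.eq_dec j (nxt n i)) as [->|]; auto.
    right; right. apply HC; auto. }
  assert (HP : orient p q r > 0) by (rewrite (orient_triangle_sum p q r y); lra).
  assert (HB := barycentric a b p q r y).
  assert (HG : forall z, In z (map v (seq 0 n)) -> 0 <= orient a b z).
  { intros z Hz. destruct (HV z Hz) as [->|[->|]];
      rewrite ?orient_eq1, ?orient_eq2; lra. }
  assert (Gp := HG p Hp). assert (Gq := HG q Hq). assert (Gr := HG r Hr).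
  (* If all three vertices were among [a] and [b], two would coincide and [orient p q r] would
     vanish. *)
  assert (Hpos : orient a b p > 0 \/ orient a b q > 0 \/ orient a b r > 0).
  { destruct (HV p Hp) as [->|[->|]]; auto;
    destruct (HV q Hq) as [->|[->|]]; auto;
    destruct (HV r Hr) as [->|[->|]]; auto;
    rewrite ?orient_eq0, ?orient_eq1, ?orient_eq2 in HP; lra. }
  assert (0 < orient a b y * orient p q r).
  { rewrite HB.
    assert (0 <= orient q r y * orient a b p) by (apply Rmult_le_pos; lra).
    assert (0 <= orient r p y * orient a b q) by (apply Rmult_le_pos; lra).
    assert (0 <= orient p q y * orient a b r) by (apply Rmult_le_pos; lra).
    destruct Hpos as [Hz|[Hz|Hz]].
    - assert (0 < orient q r y * orient a b p) by (apply Rmult_lt_0_compat; lra). lra.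
    - assert (0 < orient r p y * orient a b q) by (apply Rmult_lt_0_compat; lra). lra.
    - assert (0 < orient p q y * orient a b r) by (apply Rmult_lt_0_compat; lra). lra. }
  apply Rnot_le_gt. intro Hle.
  assert (orient a b y * orient p q r <= 0 * orient p q r)
    by (apply Rmult_le_compat_r; lra). lra.
Qed.

(** A vertex in a triangle of vertices would be interior, yet it lies on an edge line. *)
Lemma ngon_convex_position (n : nat) (v : nat -> pt) :
  convex_ngon n v -> convex_position (map v (seq 0 n)).
Proof.
  intros HC y Hy HT.
  assert (HI := triangle_interior n v y HC HT).
  apply in_vertices in Hy. destruct Hy as (i & Hi & <-).
  specialize (HI i Hi). rewrite orient_eq1 in HI. lra.
Qed.

Lemma ngon_NoDup (n : nat) (v : nat -> pt) :
  convex_ngon n v -> NoDup (map v (seq 0 n)).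
Proof.
  intros [H _]. apply NoDup_map_NoDup_ForallPairs; [|apply seq_NoDup].
  intros i j Hi Hj Hij. apply in_seq in Hi, Hj.
  destruct (Nat.eq_dec i j) as [|Hn]; auto. exfalso.
  apply (H i j); auto; lia.
Qed.

(* The sign [s] treats the upper and the lower chain at once. *)
Lemma in_triangle_sign (s : R) (l : list pt) (p q r y : pt) :
  s = 1 \/ s = -1 -> In p l -> In q l -> In r l ->
  s * orient p q y > 0 -> s * orient q r y > 0 -> s * orient r p y > 0 ->
  in_triangle l y.
Proof.
  intros [-> | ->] Hp Hq Hr H1 H2 H3.
  - exists p, q, r. repeat split; auto; lra.
  - exists p, r, q. repeat split; auto; unfold orient in *; lra.
Qed.

(** A wrong turn at [q] would put [q] into a triangle: into [a b r] if [a q r] also turns the wrong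
    way, and into [a r p] otherwise. *)
Lemma chain_of_convex_position (s : R) (X l : list pt) (a b p q r : pt) :
  s = 1 \/ s = -1 -> sep X -> incl l X -> convex_position l ->
  In a l -> In b l -> In p l -> In q l -> In r l ->
  fst a <= fst p -> fst p < fst q -> fst q < fst r -> fst r <= fst b ->
  s * orient a b q > 0 -> r = b \/ s * orient a b r > 0 ->
  s * orient p q r < 0.
Proof.
  intros Hs (_ & HX & HO) HI HC Ha Hb Hp Hq Hr Hap Hpq Hqr Hrb Habq Habr.
  apply Rnot_le_lt. intro Hle.
  assert (Hpos : s * orient p q r > 0).
  { assert (orient p q r <> 0) by (apply HO; auto).
    destruct Hs as [-> | ->]; lra. }
  assert (Haqr : orient a q r <> 0) by (apply HO; auto; lra).
  destruct (Rlt_le_dec 0 (s * orient a q r)) as [Hlt|Hge].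
  - assert (Hr' : s * orient a b r > 0).
    { destruct Habr as [->|]; auto. rewrite orient_swap in Hlt. lra. }
    assert (Hrb' : r <> b) by (intros ->; rewrite orient_eq2 in Hr'; lra).
    assert (fst r <> fst b) by (apply HX; auto).
    apply (HC q Hq). apply (in_triangle_sign s l a b r q); auto.
    + assert (E : (s * orient b r q) * (fst r - fst a) =
        (fst r - fst q) * (s * orient a b r) + (fst b - fst r) * (s * orient a q r))
        by (unfold orient; ring).
      assert (0 < (fst r - fst q) * (s * orient a b r)) by (apply Rmult_lt_0_compat; lra).
      assert (0 < (fst b - fst r) * (s * orient a q r)) by (apply Rmult_lt_0_compat; lra).
      apply Rnot_le_gt. intro Hn.
      assert ((s * orient b r q) * (fst r - fst a) <= 0 * (fst r - fst a))
        by (apply Rmult_le_compat_r; lra). lra.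
    + rewrite orient_rot. lra.
  - assert (Hneg : s * orient a q r < 0) by (destruct Hs as [-> | ->]; lra).
    apply (HC q Hq). apply (in_triangle_sign s l a r p q); auto.
    + rewrite orient_swap. lra.
    + rewrite orient_rot. lra.
    + assert (E : (s * orient p a q) * (fst r - fst q) =
        (fst q - fst a) * (s * orient p q r) - (fst q - fst p) * (s * orient a q r))
        by (unfold orient; ring).
      assert (0 < (fst q - fst a) * (s * orient p q r)) by (apply Rmult_lt_0_compat; lra).
      assert (0 < (fst q - fst p) * (- (s * orient a q r))) by (apply Rmult_lt_0_compat; lra).
      apply Rnot_le_gt. intro Hn.
      assert ((s * orient p a q) * (fst r - fst q) <= 0 * (fst r - fst q))
        by (apply Rmult_le_compat_r; lra). lra.
Qed.

(* The leftmost and rightmost points belong to both chains. *)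
Lemma convex_position_split (X l : list pt) :
  sep X -> incl l X -> NoDup l -> convex_position l -> (2 <= length l)%nat ->
  exists l1 l2, NoDup l1 /\ NoDup l2 /\ incl l1 l /\ incl l2 l /\ cap l1 /\ cup l2 /\
    (length l1 + length l2 = length l + 2)%nat.
Proof.
  intros HS HI ND HC H2.
  destruct (min_max_abscissa l) as (a & b & Ha & Hb & Hab); [lia|].
  destruct (two_ordered X l HS HI ND H2) as (p0 & q0 & Hp0 & Hq0 & Hpq0).
  assert (Hlt : fst a < fst b) by (pose proof (Hab _ Hp0); pose proof (Hab _ Hq0); lra).
  assert (HX : forall p q, In p l -> In q l -> p <> q -> fst p <> fst q)
    by (intros; apply HS; auto).
  assert (HO : forall q, In q l -> q <> a -> q <> b -> orient a b q <> 0).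
  { intros q Hq Hqa Hqb. rewrite orient_swap.
    assert (fst q <> fst a) by auto. assert (fst q <> fst b) by auto.
    pose proof (Hab _ Hq).
    assert (orient a q b <> 0) by (apply HS; auto; lra). lra. }
  (* The chord from [a] to [b] cuts [l]: the cap keeps the endpoints, and they are added again to
     the strictly lower part. *)
  destruct (partition_prop pt (fun x => x = a \/ x = b \/ orient a b x > 0) l ND)
    as (l1 & l2 & N1 & N2 & H1 & H2' & HL).
  exists l1, (a :: b :: l2). repeat split; auto.
  - constructor; [|constructor]; auto.
    + intros [E|E]; [subst; lra|]. apply H2' in E. tauto.
    + intros E. apply H2' in E. tauto.
  - intros x Hx. apply H1 in Hx. tauto.
  - intros x [<-|[<-|Hx]]; auto. apply H2' in Hx. tauto.
  - intros p q r Hp Hq Hr Hpq Hqr.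
    apply H1 in Hp, Hq, Hr.
    pose proof (Hab p (proj1 Hp)). pose proof (Hab r (proj1 Hr)).
    assert (1 * orient p q r < 0); [|lra].
    apply (chain_of_convex_position 1 X l a b p q r); auto; try tauto; try lra.
    + destruct Hq as [_ [->|[->|]]]; lra.
    + destruct Hr as [_ [->|[->|]]]; auto; lra.
  - assert (HL2 : forall x, In x (a :: b :: l2) ->
      In x l /\ (x = a \/ x = b \/ orient a b x < 0)).
    { intros x [<-|[<-|Hx]]; auto. apply H2' in Hx. destruct Hx as [Hx HN].
      split; auto. right; right. assert (orient a b x <> 0) by (apply HO; auto).
      assert (~ orient a b x > 0) by tauto. lra. }
    intros p q r Hp Hq Hr Hpq Hqr.
    apply HL2 in Hp, Hq, Hr.
    pose proof (Hab p (proj1 Hp)). pose proof (Hab r (proj1 Hr)).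
    assert (-1 * orient p q r < 0); [|lra].
    apply (chain_of_convex_position (-1) X l a b p q r); auto; try tauto; try lra.
    + destruct Hq as [_ [->|[->|]]]; lra.
    + destruct Hr as [_ [->|[->|]]]; auto; lra.
  - simpl. lia.
Qed.

(** * Placing a stretched copy of a set far away *)

(** Used to meet finitely many conditions at once; each is affine in the parameter, so a positive
    leading coefficient settles it. *)
Definition eventually (P : R -> Prop) : Prop := exists x0, forall x, x0 <= x -> P x.

Lemma eventually_and (P Q : R -> Prop) :
  eventually P -> eventually Q -> eventually (fun x => P x /\ Q x).
Proof.
  intros [a Ha] [b Hb]. exists (Rmax a b). intros x Hx.
  pose proof (Rmax_l a b). pose proof (Rmax_r a b).
  split; [apply Ha|apply Hb]; lra.
Qed.

Lemma eventually_imp (A : Prop) (P : R -> Prop) :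
  (A -> eventually P) -> eventually (fun x => A -> P x).
Proof.
  intros H. destruct (classic A) as [HA|HA].
  - destruct (H HA) as [a Ha]. exists a. auto.
  - exists 0. tauto.
Qed.

Lemma eventually_in (A : Type) (l : list A) (P : A -> R -> Prop) :
  (forall a, In a l -> eventually (P a)) ->
  eventually (fun x => forall a, In a l -> P a x).
Proof.
  induction l as [|a l IH]; intros H.
  - exists 0. simpl. tauto.
  - destruct (H a (or_introl eq_refl)) as [y Hy].
    destruct IH as [z Hz]; [intros; apply H; simpl; auto|].
    exists (Rmax y z). intros x Hx b Hb.
    pose proof (Rmax_l y z). pose proof (Rmax_r y z).
    destruct Hb as [<-|Hb]; [apply Hy; lra|apply Hz; auto; lra].
Qed.

Lemma eventually_affine (a b : R) (f : R -> R) :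
  0 < a -> (forall x, f x = a * x + b) -> eventually (fun x => 0 < f x).
Proof.
  intros Ha Hf. exists ((1 - b) / a). intros x Hx. rewrite Hf.
  assert ((1 - b) / a * a <= x * a) by (apply Rmult_le_compat_r; lra).
  assert ((1 - b) / a * a = 1 - b) by (field; lra). lra.
Qed.

Lemma eventually_ge (a : R) : eventually (fun x => a <= x).
Proof. exists a; auto. Qed.

Lemma eventually_ex (P : R -> Prop) : eventually P -> exists x, P x.
Proof. intros [a Ha]. exists a. apply Ha. lra. Qed.

(** Abstracts what is needed of an affine map in order to transport caps, cups and their bounds. *)
Definition order_preserving (f : pt -> pt) : Prop :=
  (forall p q, f p = f q -> p = q) /\
  (forall p q, fst (f p) < fst (f q) <-> fst p < fst q) /\
  exists M, 0 < M /\ forall p q r, orient (f p) (f q) (f r) = M * orient p q r.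

Lemma order_preserving_lt (f : pt -> pt) (p q : pt) :
  order_preserving f -> fst (f p) < fst (f q) -> fst p < fst q.
Proof. intros (_ & H & _). apply H. Qed.

Lemma order_preserving_orient (f : pt -> pt) (p q r : pt) :
  order_preserving f ->
  (orient (f p) (f q) (f r) < 0 <-> orient p q r < 0) /\
  (orient (f p) (f q) (f r) > 0 <-> orient p q r > 0).
Proof.
  intros (_ & _ & M & HM & HO). rewrite HO.
  destruct (Rtotal_order (orient p q r) 0) as [H|[H|H]].
  - assert (0 < M * - orient p q r) by (apply Rmult_lt_0_compat; lra). lra.
  - rewrite H. lra.
  - assert (0 < M * orient p q r) by (apply Rmult_lt_0_compat; lra). lra.
Qed.

Lemma incl_map_preimage (f : pt -> pt) (X l : list pt) :
  NoDup l -> incl l (map f X) ->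
  exists l', NoDup l' /\ incl l' X /\ l = map f l'.
Proof.
  induction l as [|a l IH]; intros ND HI.
  - exists nil. repeat split; [constructor|intros x []].
  - inversion ND as [|? ? Ha ND']; subst.
    destruct IH as (l' & N' & I' & ->); auto.
    { intros x Hx. apply HI. simpl; auto. }
    assert (Hm : In a (map f X)) by (apply HI; simpl; auto).
    apply in_map_iff in Hm. destruct Hm as (b & <- & Hb).
    exists (b :: l'). repeat split.
    + constructor; auto. intro H. apply Ha, in_map, H.
    + intros x [<-|Hx]; auto.
Qed.

Lemma map_NoDup (f : pt -> pt) (l : list pt) :
  order_preserving f -> NoDup l -> NoDup (map f l).
Proof.
  intros Hf H. apply NoDup_map_NoDup_ForallPairs; auto.
  intros p q _ _. apply Hf.
Qed.

Lemma map_sep (f : pt -> pt) (X : list pt) :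
  order_preserving f -> sep X -> sep (map f X).
Proof.
  intros Hf (ND & HX & HO). split; [apply map_NoDup; auto|]. split.
  - intros p q Hp Hq Hpq. apply in_map_iff in Hp, Hq.
    destruct Hp as (p' & <- & Hp), Hq as (q' & <- & Hq).
    assert (N : fst p' <> fst q') by (apply HX; auto; intros ->; auto).
    destruct Hf as (_ & Hlt & _). pose proof (Hlt p' q'). pose proof (Hlt q' p').
    destruct (Rtotal_order (fst p') (fst q')) as [?|[?|?]]; try tauto;
      [apply Rlt_not_eq|apply Rgt_not_eq]; apply Hlt; auto.
  - intros p q r Hp Hq Hr. apply in_map_iff in Hp, Hq, Hr.
    destruct Hp as (p' & <- & Hp), Hq as (q' & <- & Hq), Hr as (r' & <- & Hr).
    intros H1 H2. apply (order_preserving_lt f) in H1, H2; auto.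
    assert (N : orient p' q' r' <> 0) by (apply HO; auto).
    destruct (order_preserving_orient f p' q' r' Hf) as [[_ A] [_ B]].
    destruct (Rtotal_order (orient p' q' r') 0) as [H|[H|H]];
      [apply Rlt_not_eq|tauto|apply Rgt_not_eq]; auto.
Qed.

Lemma map_cap (f : pt -> pt) (l : list pt) :
  order_preserving f -> cap (map f l) -> cap l.
Proof.
  intros Hf H p q r Hp Hq Hr H1 H2.
  apply (order_preserving_orient f p q r Hf).
  apply H; try (apply in_map; auto); apply Hf; auto.
Qed.

Lemma map_cup (f : pt -> pt) (l : list pt) :
  order_preserving f -> cup (map f l) -> cup l.
Proof.
  intros Hf H p q r Hp Hq Hr H1 H2.
  apply (order_preserving_orient f p q r Hf).
  apply H; try (apply in_map; auto); apply Hf; auto.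
Qed.

Lemma map_cup_bound (f : pt -> pt) (X : list pt) (u : nat) :
  order_preserving f -> cup_bound X u -> cup_bound (map f X) u.
Proof.
  intros Hf H l ND HI HC. destruct (incl_map_preimage f X l ND HI) as (l' & N' & I' & ->).
  rewrite length_map. apply H; auto. apply (map_cup f); auto.
Qed.

Lemma map_cap_bound (f : pt -> pt) (X : list pt) (Q : list pt -> list pt -> Prop) (c : nat) :
  order_preserving f ->
  (forall l, Q X l -> Q (map f X) (map f l)) ->
  cap_bound Q X c -> cap_bound Q (map f X) c.
Proof.
  intros Hf HQ H l ND HI HC. destruct (incl_map_preimage f X l ND HI) as (l' & N' & I' & ->).
  rewrite length_map. destruct (H l' N' I' (map_cap f l' Hf HC)) as [?|[? ?]]; auto.
Qed.

Lemma map_many_under (f : pt -> pt) (X : list pt) (K : nat) (l : list pt) :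
  order_preserving f -> many_under K X l -> many_under K (map f X) (map f l).
Proof.
  intros Hf (Y & ND & HK & HY). exists (map f Y). rewrite length_map.
  split; [apply map_NoDup; auto|]. split; auto.
  intros y Hy. apply in_map_iff in Hy. destruct Hy as (y' & <- & Hy).
  destruct (HY y' Hy) as (HX & p & r & Hp & Hr & H1 & H2 & H3).
  split; [apply in_map; auto|].
  exists (f p), (f r). repeat split; try (apply in_map; auto); try (apply Hf; auto).
  apply order_preserving_orient; auto.
Qed.

(* The copy is stretched horizontally by [m], so that its own slopes become small, and moved
   to infinity in the direction of slope [s]. *)
Definition far_map (m s x : R) (p : pt) : pt := (x + m * fst p, s * x + snd p).

Lemma far_map_order_preserving (m s x : R) : 0 < m -> order_preserving (far_map m s x).
Proof.
  intros Hm. unfold far_map. split; [|split].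
  - intros [a b] [c d] H. simpl in H. injection H as H1 H2.
    assert (E : m * a = m * c) by lra. apply Rmult_eq_reg_l in E; [|lra].
    f_equal; lra.
  - intros p q. simpl. split; intro H.
    + apply (Rmult_lt_reg_l m); lra.
    + apply Rplus_lt_compat_l, Rmult_lt_compat_l; lra.
  - exists m. split; auto. intros p q r. unfold orient. simpl. ring.
Qed.

(** Once the stretch [m] is fixed, all conditions are affine in the shift [x]. In the turning
    conditions, the leading coefficient compares [s] with the slope of a secant of [S] or of the
    stretched [T]; the slope hypothesis excludes ties for [S]. *)
Lemma far_copy (S T : list pt) (s : R) :
  sep S -> sep T -> s <> 0 ->
  (forall p q, In p S -> In q S -> fst p < fst q -> s * (fst q - fst p) - (snd q - snd p) <> 0) ->
  exists f, order_preserving f /\ sep (S ++ map f T) /\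
    (forall p t, In p S -> In t (map f T) -> fst p < fst t) /\
    (s < 0 -> forall p t, In p S -> In t (map f T) -> snd t < snd p) /\
    (forall p q t, In p S -> In q S -> In t (map f T) -> fst p < fst q ->
       (s * (fst q - fst p) - (snd q - snd p) > 0 -> orient p q t > 0) /\
       (s * (fst q - fst p) - (snd q - snd p) < 0 -> orient p q t < 0)) /\
    (forall p t t', In p S -> In t (map f T) -> In t' (map f T) -> fst t < fst t' ->
       (s < 0 -> orient p t t' > 0) /\ (s > 0 -> orient p t t' < 0)) /\
    (forall t t', In t (map f T) -> In t' (map f T) -> fst t < fst t' ->
       snd t' - snd t < fst t' - fst t).
Proof.
  intros HS HT Hs Hslope.
  (* The stretched secants get slopes less than 1, and less than [Rabs s] in absolute value. *)
  assert (Em : exists m, 1 <= m /\ forall t, In t T -> forall t', In t' T -> fst t < fst t' ->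
     (0 < m * (fst t' - fst t) - (snd t' - snd t)) /\
     (0 < m * (Rabs s * (fst t' - fst t)) - (snd t' - snd t)) /\
     (0 < m * (Rabs s * (fst t' - fst t)) + (snd t' - snd t))).
  { assert (0 < Rabs s) by (apply Rabs_pos_lt; auto).
    apply eventually_ex, eventually_and; [apply eventually_ge|].
    apply eventually_in; intros t Ht. apply eventually_in; intros t' Ht'.
    apply eventually_imp; intros Hlt.
    assert (0 < Rabs s * (fst t' - fst t)) by (apply Rmult_lt_0_compat; lra).
    apply eventually_and; [|apply eventually_and];
      [apply (eventually_affine (fst t' - fst t) (- (snd t' - snd t)))
      |apply (eventually_affine (Rabs s * (fst t' - fst t)) (- (snd t' - snd t)))
      |apply (eventually_affine (Rabs s * (fst t' - fst t)) (snd t' - snd t))];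
      try lra; intros; ring. }
  destruct Em as (m & Hm1 & Hm).
  assert (Ex : exists x,
    (forall p, In p S -> forall t, In t T -> 0 < fst (far_map m s x t) - fst p) /\
    (s < 0 -> forall p, In p S -> forall t, In t T -> 0 < snd p - snd (far_map m s x t)) /\
    (forall p, In p S -> forall q, In q S -> forall t, In t T -> fst p < fst q ->
       (s * (fst q - fst p) - (snd q - snd p) > 0 -> 0 < orient p q (far_map m s x t)) /\
       (s * (fst q - fst p) - (snd q - snd p) < 0 -> 0 < - orient p q (far_map m s x t))) /\
    (forall p, In p S -> forall t, In t T -> forall t', In t' T -> fst t < fst t' ->
       (s < 0 -> 0 < orient p (far_map m s x t) (far_map m s x t')) /\
       (s > 0 -> 0 < - orient p (far_map m s x t) (far_map m s x t')))).
  { apply eventually_ex. unfold far_map, orient; simpl.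
    apply eventually_and; [|apply eventually_and; [|apply eventually_and]].
    - apply eventually_in; intros p Hp. apply eventually_in; intros t Ht.
      apply (eventually_affine 1 (m * fst t - fst p)); [lra|intros; ring].
    - apply eventually_imp; intros Hneg.
      apply eventually_in; intros p Hp. apply eventually_in; intros t Ht.
      apply (eventually_affine (- s) (snd p - snd t)); [lra|intros; ring].
    - apply eventually_in; intros p Hp. apply eventually_in; intros q Hq.
      apply eventually_in; intros t Ht. apply eventually_imp; intros Hlt.
      apply eventually_and; apply eventually_imp; intros Hsl.
      + apply (eventually_affine (s * (fst q - fst p) - (snd q - snd p))
          ((fst q - fst p) * (snd t - snd p) - (snd q - snd p) * (m * fst t - fst p)));
          [lra|intros; ring].
      + apply (eventually_affine (- (s * (fst q - fst p) - (snd q - snd p)))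
          (- ((fst q - fst p) * (snd t - snd p) - (snd q - snd p) * (m * fst t - fst p))));
          [lra|intros; ring].
    - apply eventually_in; intros p Hp. apply eventually_in; intros t Ht.
      apply eventually_in; intros t' Ht'. apply eventually_imp; intros Hlt.
      destruct (Hm t Ht t' Ht' Hlt) as (_ & M1 & M2).
      apply eventually_and; apply eventually_imp; intros Hsg.
      + rewrite Rabs_left in M1, M2 by lra.
        apply (eventually_affine ((snd t' - snd t) - s * m * (fst t' - fst t))
          ((m * fst t - fst p) * (snd t' - snd p) - (snd t - snd p) * (m * fst t' - fst p)));
          [lra|intros; ring].
      + rewrite Rabs_right in M1, M2 by lra.
        apply (eventually_affine (- ((snd t' - snd t) - s * m * (fst t' - fst t)))
          (- ((m * fst t - fst p) * (snd t' - snd p) - (snd t - snd p) * (m * fst t' - fst p))));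
          [lra|intros; ring]. }
  destruct Ex as (x & X1 & X2 & X3 & X4).
  exists (far_map m s x).
  assert (Hf : order_preserving (far_map m s x)) by (apply far_map_order_preserving; lra).
  assert (Y1 : forall p t, In p S -> In t (map (far_map m s x) T) -> fst p < fst t).
  { intros p t Hp Ht. apply in_map_iff in Ht. destruct Ht as (t0 & <- & Ht).
    specialize (X1 p Hp t0 Ht). lra. }
  assert (Y3 : forall p q t, In p S -> In q S -> In t (map (far_map m s x) T) -> fst p < fst q ->
       (s * (fst q - fst p) - (snd q - snd p) > 0 -> orient p q t > 0) /\
       (s * (fst q - fst p) - (snd q - snd p) < 0 -> orient p q t < 0)).
  { intros p q t Hp Hq Ht Hlt. apply in_map_iff in Ht. destruct Ht as (t0 & <- & Ht).
    destruct (X3 p Hp q Hq t0 Ht Hlt) as [A B].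
    split; intro H; [specialize (A H)|specialize (B H)]; lra. }
  assert (Y4 : forall p t t', In p S -> In t (map (far_map m s x) T) ->
       In t' (map (far_map m s x) T) -> fst t < fst t' ->
       (s < 0 -> orient p t t' > 0) /\ (s > 0 -> orient p t t' < 0)).
  { intros p t t' Hp Ht Ht' Hlt. apply in_map_iff in Ht, Ht'.
    destruct Ht as (t0 & <- & Ht), Ht' as (t1 & <- & Ht').
    apply (order_preserving_lt _ _ _ Hf) in Hlt. destruct (X4 p Hp t0 Ht t1 Ht' Hlt) as [A B].
    split; intro H; [specialize (A H)|specialize (B H)]; lra. }
  assert (HT' := map_sep _ T Hf HT).
  split; auto. split; [|split; [exact Y1|split; [|split; [exact Y3|split; [exact Y4|]]]]].
  - destruct HS as (NS & DS & OS), HT' as (NT & DT & OT). split; [|split].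
    + apply NoDup_app; auto. intros p Hp Hp'. specialize (Y1 p p Hp Hp'). lra.
    + intros p q Hp Hq Hpq. apply in_app_or in Hp, Hq.
      destruct Hp as [Hp|Hp], Hq as [Hq|Hq]; auto.
      * specialize (Y1 p q Hp Hq). lra.
      * specialize (Y1 q p Hq Hp). lra.
    + intros p q r Hp Hq Hr Hpq Hqr. apply in_app_or in Hp, Hq, Hr.
      destruct Hp as [Hp|Hp], Hq as [Hq|Hq], Hr as [Hr|Hr]; auto;
        try (specialize (Y1 _ _ Hq Hp); lra); try (specialize (Y1 _ _ Hr Hq); lra).
      * destruct (Y3 p q r Hp Hq Hr Hpq) as [A B].
        pose proof (Hslope p q Hp Hq Hpq).
        destruct (Rtotal_order (s * (fst q - fst p) - (snd q - snd p)) 0) as [H'|[H'|H']];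
          [specialize (B H')|tauto|specialize (A H')]; lra.
      * destruct (Y4 p q r Hp Hq Hr Hqr) as [A B].
        destruct (Rtotal_order s 0) as [H'|[H'|H']];
          [specialize (A H')|tauto|specialize (B H')]; lra.
  - intros Hneg p t Hp Ht. apply in_map_iff in Ht. destruct Ht as (t0 & <- & Ht).
    specialize (X2 Hneg p Hp t0 Ht). lra.
  - intros t t' Ht Ht' Hlt. apply in_map_iff in Ht, Ht'.
    destruct Ht as (t0 & <- & Ht), Ht' as (t1 & <- & Ht').
    apply (order_preserving_lt _ _ _ Hf) in Hlt. destruct (Hm t0 Ht t1 Ht' Hlt) as (A & _).
    unfold far_map; simpl. lra.
Qed.

(** The Erdős-Szekeres relative position, with [T] the lower set: the signs put [T] under the
    secants of [S], and [S] over those of [T]. *)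
Definition below (S T : list pt) : Prop :=
  (forall p t, In p S -> In t T -> fst p < fst t) /\
  (forall p q t, In p S -> In q S -> In t T -> fst p < fst q -> orient p q t < 0) /\
  (forall p t t', In p S -> In t T -> In t' T -> fst t < fst t' -> orient p t t' > 0).

(** The direction has a slope [- z] smaller than that of every secant of [S]. The last two clauses
    keep the slopes of all new secants below 1, as [steep_block] requires. *)
Lemma copy_below (S T : list pt) :
  sep S -> sep T ->
  exists f, order_preserving f /\ sep (S ++ map f T) /\ below S (map f T) /\
    (forall p t, In p S -> In t (map f T) -> snd t < snd p) /\
    (forall t t', In t (map f T) -> In t' (map f T) -> fst t < fst t' ->
       snd t' - snd t < fst t' - fst t).
Proof.
  intros HS HT.
  assert (E : exists z, 1 <= z /\ forall p, In p S -> forall q, In q S -> fst p < fst q ->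
     0 < z * (fst q - fst p) + (snd q - snd p)).
  { apply eventually_ex, eventually_and; [apply eventually_ge|].
    apply eventually_in; intros p Hp. apply eventually_in; intros q Hq.
    apply eventually_imp; intros Hlt.
    apply (eventually_affine (fst q - fst p) (snd q - snd p)); [lra|intros; ring]. }
  destruct E as (z & Hz & Hslope).
  destruct (far_copy S T (- z) HS HT) as (f & Hf & H1 & H2 & H3 & H4 & H5 & H6).
  - lra.
  - intros p q Hp Hq Hlt. specialize (Hslope p Hp q Hq Hlt). lra.
  - exists f. split; auto. split; auto. split; [|split; auto; apply H3; lra].
    split; auto. split.
    + intros p q t Hp Hq Ht Hlt. specialize (Hslope p Hp q Hq Hlt).
      apply (H4 p q t); auto. lra.
    + intros p t t' Hp Ht Ht' Hlt. apply (H5 p t t'); auto. lra.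
Qed.

(** Two points of [S] followed by one of [T] turn right. *)
Lemma below_cup_left (S T l1 l2 l : list pt) :
  sep S -> below S T -> NoDup l1 -> incl l1 S -> incl l2 T -> incl l1 l -> incl l2 l ->
  cup l -> (1 <= length l2)%nat -> (length l1 <= 1)%nat.
Proof.
  intros HS (B1 & B2 & _) N1 I1 I2 J1 J2 HC H.
  destruct (le_lt_dec (length l1) 1) as [|H']; auto. exfalso.
  destruct (two_ordered S l1) as (p & q & Hp & Hq & Hpq); auto.
  destruct (nonempty_length _ l2 H) as (t & Ht).
  assert (orient p q t > 0) by (apply HC; auto).
  assert (orient p q t < 0) by (apply B2; auto). lra.
Qed.

(** A point of [S] followed by two of [T] turns left. *)
Lemma below_cap_right (S T l1 l2 l : list pt) :
  sep T -> below S T -> NoDup l2 -> incl l1 S -> incl l2 T -> incl l1 l -> incl l2 l ->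
  cap l -> (1 <= length l1)%nat -> (length l2 <= 1)%nat.
Proof.
  intros HT (B1 & _ & B3) N2 I1 I2 J1 J2 HC H.
  destruct (le_lt_dec (length l2) 1) as [|H']; auto. exfalso.
  destruct (two_ordered T l2) as (p & q & Hp & Hq & Hpq); auto.
  destruct (nonempty_length _ l1 H) as (t & Ht).
  assert (orient t p q < 0) by (apply HC; auto).
  assert (orient t p q > 0) by (apply B3; auto). lra.
Qed.

(** A cap meeting [S] has at most one point in [T], hence the increment. An exceptional cap lies in
    [T], or is an exceptional cap of [S] with one point of [T] added. *)
Lemma below_cap_bound (Q : list pt -> list pt -> Prop) (S T : list pt) (c : nat) :
  monotone Q -> sep S -> sep T -> below S T ->
  cap_bound Q S c -> cap_bound Q T (1 + c) -> cap_bound Q (S ++ T) (1 + c).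
Proof.
  intros HQ HS HT HB HcS HcT l ND HI HC.
  destruct (split_app _ S T l ND HI) as (l1 & l2 & N1 & N2 & I1 & I2 & J1 & J2 & HL & _).
  destruct (le_lt_dec (length l1) 0) as [H0|H0].
  - destruct (HcT l2 N2 I2 (cap_incl _ _ J2 HC)) as [H|[H H']]; [left; lia|].
    right. split; [lia|]. revert H'. apply HQ; auto. apply incl_appr, incl_refl.
  - assert (length l2 <= 1)%nat by (eapply below_cap_right; eauto).
    destruct (HcS l1 N1 I1 (cap_incl _ _ J1 HC)) as [H1|[H1 H']]; [left; lia|].
    destruct (le_lt_dec (length l2) 0) as [H2|H2]; [left; lia|].
    right. split; [lia|]. revert H'. apply HQ; auto. apply incl_appl, incl_refl.
Qed.

Lemma below_cup_bound (S T : list pt) (u : nat) :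
  sep S -> below S T ->
  cup_bound S (1 + u) -> cup_bound T u -> cup_bound (S ++ T) (1 + u).
Proof.
  intros HS HB HcS HcT l ND HI HC.
  destruct (split_app _ S T l ND HI) as (l1 & l2 & N1 & N2 & I1 & I2 & J1 & J2 & HL & _).
  assert (H1 := HcS l1 N1 I1 (cup_incl _ _ J1 HC)).
  assert (H2 := HcT l2 N2 I2 (cup_incl _ _ J2 HC)).
  destruct (le_lt_dec (length l2) 0) as [H0|H0]; [lia|].
  assert (length l1 <= 1)%nat by (eapply (below_cup_left S T l1 l2 l); eauto). lia.
Qed.

(** * Blocks *)

Lemma binom_0_r (n : nat) : binom n 0 = 1%nat.
Proof. destruct n; reflexivity. Qed.

Lemma binom_gt (n k : nat) : (n < k)%nat -> binom n k = 0%nat.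
Proof.
  revert k. induction n as [|n IH]; intros [|k] H; simpl; auto; try lia.
  rewrite !IH; lia.
Qed.

Lemma binom_diag (n : nat) : binom n n = 1%nat.
Proof. induction n as [|n IH]; simpl; auto. rewrite IH, binom_gt; lia. Qed.

Lemma binom_pos (n k : nat) : (k <= n)%nat -> (1 <= binom n k)%nat.
Proof.
  revert k. induction n as [|n IH]; intros [|k] H; simpl; try lia.
  specialize (IH k). lia.
Qed.

Lemma binom_1_r (n : nat) : binom n 1 = n.
Proof. induction n as [|n IH]; simpl; auto. rewrite binom_0_r, IH. lia. Qed.

Lemma singleton_bounds (p : pt) (c u : nat) :
  cap_bound never (p :: nil) (S c) /\ cup_bound (p :: nil) (S u).
Proof.
  split; [intros l ND HI _; left|intros l ND HI _];
    pose proof (NoDup_incl_length ND HI); simpl in *; lia.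
Qed.

(** The Erdős-Szekeres construction: the block for [S c] and [u] is placed below the one for [c] and
    [S u], and the sizes follow Pascal's rule. *)
Lemma cap_cup_block (c u : nat) :
  exists Y, sep Y /\ length Y = binom (c + u) c /\
    cap_bound never Y (1 + c) /\ cup_bound Y (1 + u).
Proof.
  revert u. induction c as [|c IHc]; intros u.
  - exists ((0, 0) :: nil). rewrite binom_0_r.
    split; [apply sep_singleton|]. split; auto. apply singleton_bounds.
  - induction u as [|u (T & HT & LT & CT & UT)].
    + exists ((0, 0) :: nil). rewrite Nat.add_0_r, binom_diag.
      split; [apply sep_singleton|]. split; auto. apply singleton_bounds.
    + destruct (IHc (S u)) as (X & HX & LX & CX & UX).
      destruct (copy_below X T HX HT) as (f & Hf & HS & HB & _).
      exists (X ++ map f T). split; auto. split; [|split].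
      * rewrite length_app, length_map, LX, LT.
        replace (S c + S u)%nat with (S (c + S u)) by lia.
        replace (S c + u)%nat with (c + S u)%nat by lia. simpl. lia.
      * apply below_cap_bound; auto using monotone_never, map_sep.
        apply map_cap_bound; auto.
      * apply below_cup_bound; auto. apply map_cup_bound; auto.
Qed.

(** On the parabola [y = x^2 + 2 x] at nonnegative abscissas, the linear term makes every secant
    steeper than 1, the slope of the direction used in [enlarged_block]. *)
Definition steep_cup (u : nat) : list pt :=
  map (fun i => (INR i, INR i * INR i + 2 * INR i)) (seq 0 u).

Lemma steep_cup_in (u : nat) (p : pt) :
  In p (steep_cup u) -> 0 <= fst p /\ snd p = fst p * fst p + 2 * fst p.
Proof.
  unfold steep_cup. rewrite in_map_iff. intros (i & <- & _). simpl.
  split; [apply pos_INR|ring].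
Qed.

Lemma steep_cup_slope (u : nat) (p q : pt) :
  In p (steep_cup u) -> In q (steep_cup u) -> fst p < fst q ->
  fst q - fst p < snd q - snd p.
Proof.
  intros Hp Hq H. apply steep_cup_in in Hp, Hq.
  destruct Hp as [Hp ->], Hq as [Hq ->].
  assert (0 <= (fst q - fst p) * (fst q + fst p)) by (apply Rmult_le_pos; lra). lra.
Qed.

Lemma steep_cup_cup (u : nat) : cup (steep_cup u).
Proof.
  intros p q r Hp Hq Hr H1 H2. apply steep_cup_in in Hp, Hq, Hr.
  destruct Hp as [_ Hp], Hq as [_ Hq], Hr as [_ Hr]. unfold orient.
  rewrite Hp, Hq, Hr.
  (* The area is a Vandermonde product; the linear term cancels. *)
  replace (_ - _) with ((fst q - fst p) * (fst r - fst q) * (fst r - fst p)) by ring.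
  apply Rmult_lt_0_compat; [apply Rmult_lt_0_compat|]; lra.
Qed.

Lemma steep_cup_sep (u : nat) : sep (steep_cup u).
Proof.
  split; [|split].
  - apply NoDup_map_NoDup_ForallPairs; [|apply seq_NoDup].
    intros i j _ _ H. injection H as H _. apply INR_eq; auto.
  - intros p q Hp Hq Hpq E. apply steep_cup_in in Hp, Hq. apply Hpq.
    destruct p, q; simpl in *. destruct Hp as [_ ->], Hq as [_ ->]. rewrite E. auto.
  - intros p q r Hp Hq Hr H1 H2. pose proof (steep_cup_cup u p q r Hp Hq Hr H1 H2). lra.
Qed.

Lemma three_ordered (X l : list pt) :
  sep X -> incl l X -> NoDup l -> (3 <= length l)%nat ->
  exists p q r, In p l /\ In q l /\ In r l /\ fst p < fst q /\ fst q < fst r.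
Proof.
  intros (_ & HX & _) HI ND H3.
  destruct (min_max_abscissa l) as (a & b & Ha & Hb & Hab); [lia|].
  destruct (classic (incl l (a :: b :: nil))) as [H|H].
  - apply NoDup_incl_length in H; auto. simpl in H. lia.
  - destruct (not_all_ex_not _ _ H) as (q & Hq). apply imply_to_and in Hq.
    destruct Hq as [Hq Hn]. exists a, q, b. repeat split; auto;
      destruct (Hab q Hq) as [A B].
    + assert (fst a <> fst q) by (apply HX; auto; intros ->; simpl in Hn; tauto). lra.
    + assert (fst q <> fst b) by (apply HX; auto; intros ->; simpl in Hn; tauto). lra.
Qed.

Lemma steep_cup_cap_bound (u : nat) : cap_bound never (steep_cup u) 2.
Proof.
  intros l ND HI HC. left.
  destruct (le_lt_dec (length l) 2) as [|H]; auto. exfalso.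
  destruct (three_ordered (steep_cup u) l) as (p & q & r & Hp & Hq & Hr & H1 & H2);
    auto using steep_cup_sep.
  assert (orient p q r < 0) by auto.
  assert (orient p q r > 0) by (apply (steep_cup_cup u); auto). lra.
Qed.

(** This set has one point more than the block with cap bound [b + 2] and cup bound [w + 2]; the
    price is that the steep cup itself has [w + 3] points. Each induction step puts an ordinary
    block below and to the right, which enlarges [D] by Pascal's rule. *)
Lemma steep_block (w b : nat) :
  exists D, sep (steep_cup (w + 3) ++ D) /\
    (length D + (w + 2) = binom (b + w + 2) (b + 1))%nat /\
    cap_bound never (steep_cup (w + 3) ++ D) (b + 2) /\
    (forall l, NoDup l -> incl l (steep_cup (w + 3) ++ D) -> cup l ->
       incl l (steep_cup (w + 3)) \/ (length l <= w + 2)%nat) /\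
    (forall v d, In v (steep_cup (w + 3)) -> In d D -> fst v < fst d) /\
    (forall p q, In p (steep_cup (w + 3) ++ D) -> In q (steep_cup (w + 3) ++ D) ->
       fst p < fst q ->
       (In p (steep_cup (w + 3)) /\ In q (steep_cup (w + 3))) \/
       snd q - snd p < fst q - fst p).
Proof.
  set (V := steep_cup (w + 3)).
  induction b as [|b (D & HS & HL & HC & HU & HVD & Hsl)].
  - exists nil. rewrite app_nil_r.
    split; [apply steep_cup_sep|]. split; [|split; [apply steep_cup_cap_bound|]].
    + simpl length. rewrite binom_1_r. lia.
    + split; auto. split; [simpl; tauto|auto].
  - destruct (cap_cup_block (b + 2) w) as (T & HT & LT & CT & UT).
    destruct (copy_below (V ++ D) T HS HT) as (f & Hf & HST & HB & Hlow & Hflat).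
    exists (D ++ map f T). rewrite app_assoc.
    split; auto. split; [|split; [|split; [|split]]].
    + rewrite length_app, length_map, LT.
      replace (S b + w + 2)%nat with (S (b + w + 2)) by lia.
      replace (S b + 1)%nat with (S (b + 1)) by lia. simpl.
      replace (S (b + 1)) with (b + 2)%nat by lia.
      replace (b + 2 + w)%nat with (b + w + 2)%nat by lia. lia.
    + apply (below_cap_bound never _ _ (b + 2)); auto using monotone_never, map_sep.
      apply map_cap_bound; auto.
    + intros l ND HI Hcup.
      destruct (split_app _ _ _ l ND HI)
        as (l1 & l2 & N1 & N2 & I1 & I2 & J1 & J2 & HLl & HX).
      destruct (le_lt_dec (length l2) 0) as [H0|H0].
      * destruct l2; [|simpl in H0; lia].
        destruct (HU l1 N1 I1 (cup_incl _ _ J1 Hcup)) as [H|H].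
        -- left. intros x Hx. destruct (HX x Hx) as [?|[]]; auto.
        -- right. simpl in HLl. lia.
      * right. assert (length l1 <= 1)%nat 
          by (apply (below_cup_left (V ++ D) (map f T) l1 l2 l); auto).
        assert (length l2 <= 1 + w)%nat.
        { apply (map_cup_bound f T _ Hf); auto. apply (cup_incl _ _ J2 Hcup). }
        lia.
    + intros v d Hv Hd. apply in_app_or in Hd. destruct Hd as [Hd|Hd]; auto.
      apply HB; auto. apply in_or_app; auto.
    + intros p q Hp Hq Hpq. apply in_app_or in Hp, Hq.
      destruct Hp as [Hp|Hp], Hq as [Hq|Hq].
      * auto.
      (* The new points lie lower, so this secant descends. *)
      * right. specialize (Hlow p q Hp Hq). lra.
      * pose proof (proj1 HB q p Hq Hp). lra.
      * right. auto.
Qed.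

(* Seen from the last set, placed in the direction of slope 1, the steep lines of
   [steep_cup (w + 3)] pass on the other side than all remaining lines of the steep block:
   two points of the steep cup may both precede a cap, but then all of [D] lies under it. *)
Lemma enlarged_block (w b K : nat) :
  (K + (w + 2) = binom (b + w + 2) (b + 1))%nat ->
  exists M, sep M /\ length M = S (binom (b + w + 3) (b + 1)) /\
    cap_bound (many_under K) M (b + 2) /\ cup_bound M (w + 3).
Proof.
  intros HK.
  destruct (steep_block w b) as (D & HS & HL & HC & HU & HVD & Hsl).
  set (V := steep_cup (w + 3)) in *.
  assert (LV : length V = (w + 3)%nat)
    by (unfold V, steep_cup; rewrite length_map, length_seq; auto).
  (* An ordinary block with cap bound [b + 1] and cup bound [w + 3], whose size completes Pascal's
     rule. *)
  destruct (cap_cup_block b (w + 2)) as (P & HP & LP & CP & UP).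
  destruct (far_copy (V ++ D) P 1 HS HP) as (f & Hf & HM & Hleft & _ & Hside & Hflat & _).
  { lra. }
  (* No secant has slope 1: those of the steep cup are steeper, all others flatter. *)
  { intros p q Hp Hq Hpq. destruct (Hsl p q Hp Hq Hpq) as [[Vp Vq]|]; [|lra].
    pose proof (steep_cup_slope _ p q Vp Vq Hpq). lra. }
  assert (CP' : cap_bound never (map f P) (1 + b)) by (apply map_cap_bound; auto).
  assert (UP' : cup_bound (map f P) (1 + (w + 2))) by (apply map_cup_bound; auto).
  set (P' := map f P) in *.
  assert (Hturn : forall p q t, In p (V ++ D) -> In q (V ++ D) -> In t P' -> fst p < fst q ->
            orient p q t > 0 \/ (In p V /\ In q V)).
  { intros p q t Hp Hq Ht Hpq. destruct (Hsl p q Hp Hq Hpq) as [?|H]; auto.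
    left. apply (Hside p q t Hp Hq Ht Hpq). lra. }
  assert (HturnV : forall p q t, In p V -> In q V -> In t P' -> fst p < fst q ->
            orient p q t < 0).
  { intros p q t Hp Hq Ht Hpq. pose proof (steep_cup_slope _ p q Hp Hq Hpq).
    apply (Hside p q t); auto; [apply in_or_app; auto|apply in_or_app; auto|lra]. }
  exists ((V ++ D) ++ P'). split; auto. split; [|split].
  - unfold P'. rewrite !length_app, length_map, LV, LP.
    replace (b + 1)%nat with (S b) in * by lia.
    replace (b + w + 3)%nat with (S (b + w + 2)) by lia. simpl.
    replace (b + (w + 2))%nat with (b + w + 2)%nat by lia. lia.
  - intros l ND HI Hcap.
    destruct (split_app _ _ _ l ND HI)
      as (l1 & l2 & N1 & N2 & I1 & I2 & J1 & J2 & HLl & _).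
    assert (L1 := cap_bound_never_le _ _ _ HC N1 I1 (cap_incl _ _ J1 Hcap)).
    assert (L2 := cap_bound_never_le _ _ _ CP' N2 I2 (cap_incl _ _ J2 Hcap)).
    destruct (le_lt_dec (length l2) 0) as [H0|H0]; [left; lia|].
    destruct (le_lt_dec (length l1) 1) as [H1|H1]; [left; lia|].
    destruct (nonempty_length _ l2 H0) as (t & Ht).
    (* Two points of [l1] and then [t] turn right, which happens only for pairs in the steep cup. *)
    assert (IV : incl l1 V).
    { intros x Hx.
      assert (Hy : exists y, In y l1 /\ x <> y).
      { destruct (two_elements _ l1 N1 H1) as (y & z & Hy & Hz & Hyz).
        destruct (classic (x = y)) as [->|]; [exists z|exists y]; auto. }
      destruct Hy as (y & Hy & Hxy).
      assert (fst x <> fst y) by (apply HS; auto).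
      assert (G : forall p q, In p l1 -> In q l1 -> fst p < fst q -> In p V /\ In q V).
      { intros p q Hp Hq Hpq. destruct (Hturn p q t) as [H'|]; auto.
        assert (orient p q t < 0) by (apply Hcap; auto). lra. }
      destruct (Rtotal_order (fst x) (fst y)) as [H'|[H'|H']]; [|tauto|];
        apply G in H'; tauto. }
    (* A cap inside a cup has at most two points, so [l] has at most [2 + (b + 1)]. *)
    assert (L1' := cap_bound_never_le _ _ _ (steep_cup_cap_bound _) N1 IV
              (cap_incl _ _ J1 Hcap)).
    destruct (le_lt_dec (length l) (b + 2)) as [|HLb]; auto.
    right. split; [lia|].
    destruct (nonempty_length _ l1) as (v & Hv); [lia|].
    (* A point [y] of [D] is not in the steep cup, so [v y t] turns left and [y] lies under the
       chord from [v] to [t]. *)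
    exists D. split; [|split; [lia|]].
    { destruct HS as [HS _]. apply NoDup_app_remove_l in HS. auto. }
    intros y Hy. assert (HyE : In y (V ++ D)) by (apply in_or_app; auto).
    split; [apply in_or_app; auto|].
    exists v, t. repeat split; auto.
    rewrite orient_swap. destruct (Hturn v y t) as [H'|[_ H']]; auto.
    + lra.
    + pose proof (HVD y y H' Hy). lra.
  - intros l ND HI Hcup.
    destruct (split_app _ _ _ l ND HI)
      as (l1 & l2 & N1 & N2 & I1 & I2 & J1 & J2 & HLl & _).
    assert (L1 := HU l1 N1 I1 (cup_incl _ _ J1 Hcup)).
    assert (L2 := UP' l2 N2 I2 (cup_incl _ _ J2 Hcup)).
    destruct (le_lt_dec (length l2) 0) as [H0|H0].
    { destruct L1 as [H|H]; [|lia].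
      pose proof (NoDup_incl_length N1 H). lia. }
    destruct (le_lt_dec (length l1) 0) as [H1|H1]; [lia|].
    destruct (nonempty_length _ l2 H0) as (t & Ht).
    destruct (nonempty_length _ l1 H1) as (e & He).
    assert (length l2 <= 1)%nat.
    { destruct (le_lt_dec (length l2) 1) as [|H2]; auto. exfalso.
      destruct (two_ordered P' l2) as (p & q & Hp & Hq & Hpq); auto.
      { apply map_sep; auto. }
      assert (orient e p q > 0) by (apply Hcup; auto).
      assert (orient e p q < 0) by (apply Hflat; auto; lra). lra. }
    destruct (le_lt_dec (length l1) 1) as [H2|H2]; [lia|].
    (* The remaining case has two points of the steep cup before [t], and these turn right. *)
    destruct L1 as [HV|HV]; [|lia]. exfalso.
    destruct (two_ordered (V ++ D) l1) as (p & q & Hp & Hq & Hpq); auto.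
    assert (orient p q t > 0) by (apply Hcup; auto).
    assert (orient p q t < 0) by (apply HturnV; auto). lra.
Qed.

(** * Stacking the blocks *)

(** If three upper points turned left, the middle one would be inside the triangle of the outer two
    and a lower point; symmetrically for the lower part. *)
Lemma convex_position_below (S T l l1 l2 : list pt) :
  sep S -> sep T -> below S T -> convex_position l -> incl l1 l -> incl l2 l ->
  incl l1 S -> incl l2 T -> (1 <= length l1)%nat -> (1 <= length l2)%nat ->
  cap l1 /\ cup l2.
Proof.
  intros (_ & _ & OS) (_ & _ & OT) (B1 & B2 & B3) HC J1 J2 I1 I2 H1 H2.
  destruct (nonempty_length _ l1 H1) as (s & Hs).
  destruct (nonempty_length _ l2 H2) as (t & Ht).
  split; intros p q r Hp Hq Hr Hpq Hqr.
  - assert (orient p q r <> 0) by (apply OS; auto).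
    destruct (Rlt_le_dec (orient p q r) 0) as [|Hle]; auto. exfalso.
    apply (HC q (J1 q Hq)). exists p, t, r. repeat split; auto.
    + rewrite orient_swap. assert (orient p q t < 0) by (apply B2; auto). lra.
    + rewrite orient_swap, (orient_rot t q r).
      assert (orient q r t < 0) by (apply B2; auto). lra.
    + rewrite orient_rot. lra.
  - assert (orient p q r <> 0) by (apply OT; auto).
    apply Rnot_le_gt. intros Hle.
    apply (HC q (J2 q Hq)). exists p, r, s. repeat split; auto.
    + rewrite orient_swap. lra.
    + rewrite orient_rot. assert (orient s q r > 0) by (apply B3; auto). lra.
Qed.

(** A polygon meeting block [j] and earlier ones is a cap of the earlier union and a cup of block
    [j]. The regular bounds [j] and [n - 1 - j] add up to [n - 1] only, so with [n] points the cap
    is exceptional. *)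
Lemma stack (n K : nat) (size : nat -> nat) :
  (forall i, (i + 2 <= n)%nat -> exists T, sep T /\ (size i <= length T)%nat /\
     cap_bound (many_under K) T (1 + i) /\ cup_bound T (n - 1 - i)) ->
  forall j, (j + 1 <= n)%nat -> exists S, sep S /\
    (list_sum (map size (seq 0 j)) <= length S)%nat /\
    cap_bound (many_under K) S j /\
    forall l, NoDup l -> incl l S -> convex_position l -> (n <= length l)%nat ->
      many_inside K S l.
Proof.
  intros HT j. induction j as [|j IH]; intros Hj.
  - exists nil. split; [apply sep_nil|]. split; auto. split.
    + intros l ND HI _. apply NoDup_incl_length in HI; auto.
    + intros l ND HI _ Hn. apply NoDup_incl_length in HI; auto. simpl in HI. lia.
  - destruct IH as (S & HS & LS & CS & GS); [lia|].
    destruct (HT j) as (T & HT' & LT & CT & UT); [lia|].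
    destruct (copy_below S T HS HT') as (f & Hf & HST & HB & _).
    assert (CT' : cap_bound (many_under K) (map f T) (1 + j))
      by (apply map_cap_bound; auto; intros; apply map_many_under; auto).
    assert (UT' : cup_bound (map f T) (n - 1 - j)) by (apply map_cup_bound; auto).
    assert (HfT : sep (map f T)) by (apply map_sep; auto).
    assert (Lf : length (map f T) = length T) by apply length_map.
    set (T' := map f T) in *.
    exists (S ++ T'). split; auto. split; [|split].
    + rewrite seq_S, map_app, list_sum_app, length_app. simpl. lia.
    + apply below_cap_bound; auto using monotone_many_under.
    + intros l ND HI HC Hn.
      destruct (split_app _ _ _ l ND HI)
        as (l1 & l2 & N1 & N2 & I1 & I2 & J1 & J2 & HL & _).
      destruct (le_lt_dec (length l2) 0) as [H2|H2].
      { apply (monotone_many_inside K S _ l1); auto. { apply incl_appl, incl_refl. }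
        apply GS; auto; [|lia]. apply (incl_convex_position l1 l); auto. }
      destruct (le_lt_dec (length l1) 0) as [H1|H1].
      (* Within one block, cap and cup share two endpoints, so their sizes add up to at least
         [n + 2], while even an exceptional cap gives at most [(j + 2) + (n - 1 - j) = n + 1]. *)
      { exfalso. destruct (convex_position_split T' l2)
          as (a & b & Na & Nb & Ia & Ib & Ca & Cb & Hab); auto; try lia.
        { apply (incl_convex_position l2 l); auto. }
        assert (length b <= n - 1 - j)%nat by (apply UT'; auto; eapply incl_tran; eauto).
        destruct (CT' a Na (incl_tran Ia I2) Ca) as [?|[? _]]; lia. }
      destruct (convex_position_below S T' l l1 l2) as [Hcap Hcup]; auto.
      assert (L2 := UT' l2 N2 I2 Hcup).
      destruct (CS l1 N1 I1 Hcap) as [?|[L1 (Y & NY & KY & HY)]]; [lia|].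
      destruct (nonempty_length _ l2 H2) as (t & Ht).
      exists Y. split; auto. split; auto. intros y Hy.
      destruct (HY y Hy) as (HyS & p & r & Hp & Hr & Hpy & Hyr & Hpry).
      split; [apply in_or_app; auto|].
      destruct HB as (_ & B2 & _).
      (* The chord from [p] to [r] passes above [y], and [t] is far below: a counterclockwise
         triangle around [y]. *)
      exists p, t, r. repeat split; auto.
      * rewrite orient_swap. assert (orient p y t < 0) by (apply B2; auto). lra.
      * rewrite orient_swap, (orient_rot t y r).
        assert (orient y r t < 0) by (apply B2; auto). lra.
      * rewrite orient_rot, orient_swap. lra.
Qed.

(** * Binomial row sums and the final count *)

Lemma binom_partial_sum (m j : nat) :
  list_sum (map (binom (S m)) (seq 0 (S j))) =
  (list_sum (map (binom m) (seq 0 (S j))) + list_sum (map (binom m) (seq 0 j)))%nat.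
Proof.
  induction j as [|j IH].
  - simpl. rewrite binom_0_r. auto.
  - rewrite (seq_S (S j)), !map_app, !list_sum_app, IH, (seq_S j), !map_app, !list_sum_app.
    simpl. lia.
Qed.

Lemma binom_row_sum (m : nat) : list_sum (map (binom m) (seq 0 (S m))) = (2 ^ m)%nat.
Proof.
  induction m as [|m IH]; auto.
  rewrite binom_partial_sum, (seq_S (S m)), map_app, list_sum_app, IH.
  simpl. rewrite binom_gt by lia. lia.
Qed.

Lemma enlarged_sum (g : nat -> nat) (k j : nat) :
  list_sum (map (fun i => g i + if i =? k then 1 else 0)%nat (seq 0 j)) =
  (list_sum (map g (seq 0 j)) + if k <? j then 1 else 0)%nat.
Proof.
  induction j as [|j IH]; auto.
  rewrite seq_S, !map_app, !list_sum_app, IH. simpl.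
  destruct (Nat.ltb_spec k j), (Nat.ltb_spec k (S j)), (Nat.eqb_spec j k); lia.
Qed.

Theorem mainTheorem4 :
  forall n : nat, (6 <= n)%nat ->
  exists X : list pt,
    general_position X /\
    (2 ^ (n - 2) + 1 <= length X)%nat /\
    forall v : nat -> pt,
      (forall i, (i < n)%nat -> In (v i) X) ->
      convex_ngon n v ->
      exists Y : list pt,
        NoDup Y /\
        (forall y, In y Y -> In y X /\ in_interior n v y) /\
        (kval n < length Y)%nat.
Proof.
  intros n Hn.
  (* The enlarged block has index [b + 2]; its cap bound [b + 3] and cup bound [w + 3] are the floor
     and the ceiling of [n / 2]. *)
  assert (E : exists b w, n = (b + w + 6)%nat /\ ceil_half (n - 3) = (b + 2)%nat /\
                ceil_half n = (w + 3)%nat).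
  { exists (ceil_half (n - 3) - 2)%nat, (ceil_half n - 3)%nat. unfold ceil_half.
    pose proof (Nat.div_mod_eq (n - 3 + 1) 2). pose proof (Nat.div_mod_eq (n + 1) 2).
    pose proof (Nat.mod_upper_bound (n - 3 + 1) 2). pose proof (Nat.mod_upper_bound (n + 1) 2).
    lia. }
  destruct E as (b & w & Hbw & Hb & Hw).
  (* Makes the truncated subtractions in [kval] and [K] exact, so that [K] is [kval n + 1]. *)
  assert (Hbin : (w + 3 <= binom (b + 1 + w + 2) (b + 1 + 1))%nat).
  { destruct (steep_block w b) as (D & _ & HL & _).
    assert (1 <= binom (b + w + 2) (b + 2))%nat by (apply binom_pos; lia).
    replace (b + 1 + w + 2)%nat with (S (b + w + 2)) by lia.
    replace (b + 1 + 1)%nat with (S (b + 1)) by lia. simpl.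
    replace (S (b + 1)) with (b + 2)%nat by lia. lia. }
  set (K := (binom (b + 1 + w + 2) (b + 1 + 1) - (w + 2))%nat).
  assert (HK : (kval n < K)%nat).
  { unfold kval. rewrite Hb, Hw.
    replace (n - 3)%nat with (b + 1 + w + 2)%nat by lia.
    replace (b + 2)%nat with (b + 1 + 1)%nat by lia. lia. }
  (* The sizes are row [n - 2] of Pascal's triangle, with total [2 ^ (n - 2)], plus the extra point
     of the enlarged block. *)
  destruct (stack n K (fun i => binom (n - 2) i + if i =? (b + 2) then 1 else 0)%nat)
    with (j := (n - 1)%nat) as (X & HX & LX & _ & GX); [|lia|].
  { intros i Hi. destruct (Nat.eqb_spec i (b + 2)) as [->|_].
    - destruct (enlarged_block w (b + 1) K) as (M & HM & LM & CM & UM); [lia|].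
      exists M. split; auto. split; [|split].
      + rewrite LM. replace (b + 1 + w + 3)%nat with (n - 2)%nat by lia.
        replace (b + 1 + 1)%nat with (b + 2)%nat by lia. lia.
      + replace (1 + (b + 2))%nat with (b + 1 + 2)%nat by lia. auto.
      + replace (n - 1 - (b + 2))%nat with (w + 3)%nat by lia. auto.
    - destruct (cap_cup_block i (n - 2 - i)) as (Y & HY & LY & CY & UY).
      exists Y. split; auto. split; [|split; [apply cap_bound_never; auto|]].
      + rewrite LY. replace (i + (n - 2 - i))%nat with (n - 2)%nat by lia. lia.
      + replace (n - 1 - i)%nat with (1 + (n - 2 - i))%nat by lia. auto. }
  rewrite enlarged_sum in LX. replace (n - 1)%nat with (S (n - 2)) in LX by lia.
  rewrite binom_row_sum in LX.
  destruct (Nat.ltb_spec (b + 2) (S (n - 2))); [|lia].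
  exists X. split; [apply sep_general_position; auto|]. split; [lia|].
  intros v Hv HC.
  destruct (GX (map v (seq 0 n))) as (Y & NY & KY & HY).
  - apply ngon_NoDup; auto.
  - intros p Hp. apply in_vertices in Hp. destruct Hp as (i & Hi & <-). auto.
  - apply ngon_convex_position; auto.
  - rewrite length_map, length_seq. lia.
  - exists Y. split; auto. split; [|lia].
    intros y Hy. destruct (HY y Hy) as [H1 H2]. split; auto.
    apply triangle_interior; auto.
Qed.
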